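(* Let $\mathcal M$ be a left GV-module category over a GV-category $\mathcal C$, with right and left module distributors $\delta^{\mathrm r}$ and $\delta^{\mathrm l}$. For all $x,y,z\in\mathcal C$ and $m\in\mathcal M$ the following six pentagon diagrams commute (isomorphisms labelled $\cong$ are associators or module constraints): 1. (distributor $\delta^{\mathrm r}$) (a) the two composites $((x\odot y)\odot z)\triangleright m\to x\blacktriangleright(y\blacktriangleright(z\triangleright m))$ agree: $((x\odot y)\odot z)\triangleright m\cong(x\odot(y\odot z))\triangleright m\xrightarrow{\delta^{\mathrm r}_{x,y\odot z,m}}x\blacktriangleright((y\odot z)\triangleright m)\xrightarrow{x\blacktriangleright\delta^{\mathrm r}_{y,z,m}}x\blacktriangleright(y\blacktriangleright(z\triangleright m))$ and $((x\odot y)\odot z)\triangleright m\xrightarrow{\delta^{\mathrm r}_{x\odot y,z,m}}(x\odot y)\blacktriangleright(z\triangleright m)\cong x\blacktriangleright(y\blacktriangleright(z\triangleright m))$; (b) the two composites $(x\odot y)\triangleright(z\triangleright m)\to x\blacktriangleright(y\triangleright(z\triangleright m))$ agree: $\delta^{\mathrm r}_{x,y,z\triangleright m}$ and $(x\odot y)\triangleright(z\triangleright m)\cong((x\odot y)\otimes z)\triangleright m\xrightarrow{\delta^{\mathrm r}_{x,y,z}\triangleright m}(x\odot(y\otimes z))\triangleright m\xrightarrow{\delta^{\mathrm r}_{x,y\otimes z,m}}x\blacktriangleright((y\otimes z)\triangleright m)\cong x\blacktriangleright(y\triangleright(z\triangleright m))$. 2. (distributor $\delta^{\mathrm l}$)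 (a) the two composites $(x\otimes y)\triangleright(z\blacktriangleright m)\to(x\otimes(y\otimes z))\blacktriangleright m$ agree: $(x\otimes y)\triangleright(z\blacktriangleright m)\xrightarrow{\delta^{\mathrm l}_{x\otimes y,z,m}}((x\otimes y)\otimes z)\blacktriangleright m\cong(x\otimes(y\otimes z))\blacktriangleright m$ and $(x\otimes y)\triangleright(z\blacktriangleright m)\cong x\triangleright(y\triangleright(z\blacktriangleright m))\xrightarrow{x\triangleright\delta^{\mathrm l}_{y,z,m}}x\triangleright((y\otimes z)\blacktriangleright m)\xrightarrow{\delta^{\mathrm l}_{x,y\otimes z,m}}(x\otimes(y\otimes z))\blacktriangleright m$; (b) the two composites $x\triangleright((y\odot z)\blacktriangleright m)\to(x\otimes y)\blacktriangleright(z\blacktriangleright m)$ agree: $x\triangleright((y\odot z)\blacktriangleright m)\xrightarrow{\delta^{\mathrm l}_{x,y\odot z,m}}(x\otimes(y\odot z))\blacktriangleright m\xrightarrow{\delta^{\mathrm l}_{x,y,z}\blacktriangleright m}((x\otimes y)\odot z)\blacktriangleright m\cong(x\otimes y)\blacktriangleright(z\blacktriangleright m)$ and $x\triangleright((y\odot z)\blacktriangleright m)\cong x\triangleright(y\blacktriangleright(z\blacktriangleright m))\xrightarrow{\delta^{\mathrm l}_{x,y,z\blacktriangleright m}}(x\otimes y)\blacktriangleright(z\blacktriangleright m)$. 3. (mixed pentagons) (a) the two composites $(x\otimes(y\odot z))\triangleright m\to(x\otimes y)\blacktriangleright(z\triangleright m)$ agree: $(x\otimes(y\odot z))\triangleright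 m\xrightarrow{\delta^{\mathrm l}_{x,y,z}\triangleright m}((x\otimes y)\odot z)\triangleright m\xrightarrow{\delta^{\mathrm r}_{x\otimes y,z,m}}(x\otimes y)\blacktriangleright(z\triangleright m)$ and $(x\otimes(y\odot z))\triangleright m\cong x\triangleright((y\odot z)\triangleright m)\xrightarrow{x\triangleright\delta^{\mathrm r}_{y,z,m}}x\triangleright(y\blacktriangleright(z\triangleright m))\xrightarrow{\delta^{\mathrm l}_{x,y,z\triangleright m}}(x\otimes y)\blacktriangleright(z\triangleright m)$; (b) the two composites $(x\odot y)\triangleright(z\blacktriangleright m)\to x\blacktriangleright((y\otimes z)\blacktriangleright m)$ agree: $(x\odot y)\triangleright(z\blacktriangleright m)\xrightarrow{\delta^{\mathrm r}_{x,y,z\blacktriangleright m}}x\blacktriangleright(y\triangleright(z\blacktriangleright m))\xrightarrow{x\blacktriangleright\delta^{\mathrm l}_{y,z,m}}x\blacktriangleright((y\otimes z)\blacktriangleright m)$ and $(x\odot y)\triangleright(z\blacktriangleright m)\xrightarrow{\delta^{\mathrm l}_{x\odot y,z,m}}((x\odot y)\otimes z)\blacktriangleright m\xrightarrow{\delta^{\mathrm r}_{x,y,z}\blacktriangleright m}(x\odot(y\otimes z))\blacktriangleright m\cong x\blacktriangleright((y\otimes z)\blacktriangleright m)$.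
   Context: A GV-category is a monoidal category $(\mathcal C,\otimes,1)$ with a chosen dualizing object $K$: for every $y$ the functor $x\mapsto\mathrm{Hom}(x\otimes y,K)$ is represented by an object $Gy$, and the resulting contravariant functor $G$ is an anti-equivalence. The second tensor product is $x\odot y:=G^{-1}(Gy\otimes Gx)$, with unit $K$ and associator and unitors obtained by applying $G^{-1}$ to those of $\otimes$. A left GV-module category is a left module category $(\mathcal M,\triangleright)$ over $(\mathcal C,\otimes)$ such that all functors $c\triangleright{-}$ and ${-}\triangleright m$ have right adjoints. Let $c\blacktriangleright{-}$ be a fixed right adjoint of $Gc\triangleright{-}$; $\blacktriangleright$ is an action of $(\mathcal C,\odot)$ on $\mathcal M$ (module constraint induced via the Yoneda lemma). Write $\mathrm{ev}_{c,m}\colon Gc\triangleright(c\blacktriangleright m)\to m$ and $\mathrm{coev}_{c,m}\colon m\to c\blacktriangleright(Gc\triangleright m)$ for the counit and unit. For the regular module $\mathcal M=\mathcal C$, $\triangleright=\otimes$, the right adjoint of $c\otimes{-}$ is chosen to be $G^{-1}c\odot{-}$, so that $\blacktriangleright=\odot$. Module distributors (natural, not necessarily invertible): the right module distributor $\delta^{\mathrm r}_{x,y,m}\colon(x\odot y)\triangleright m\to x\blacktriangleright(y\triangleright m)$ is the composite $(x\odot y)\triangleright m\xrightarrow{\mathrm{coev}}x\blacktriangleright(Gx\triangleright((x\odot y)\triangleright m))\cong x\blacktriangleright((Gx\otimes(x\odot y))\triangleright m)\xrightarrow{x\blacktriangleright(\mathrm{ev}_{x,y}\triangleright m)}x\blacktriangleright(y\triangleright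 m)$, i.e. the oplax $\blacktriangleright$-module structure conjugated to the strong $\triangleright$-module structure of the functor ${-}\triangleright m\colon\mathcal C\to\mathcal M$. The left module distributor $\delta^{\mathrm l}_{x,y,m}\colon x\triangleright(y\blacktriangleright m)\to(x\otimes y)\blacktriangleright m$ is, with $c:=G^{-1}x$, the composite $x\triangleright(y\blacktriangleright m)\xrightarrow{x\triangleright(\mathrm{coev}_{c,y}\blacktriangleright m)}x\triangleright((c\odot(x\otimes y))\blacktriangleright m)\cong x\triangleright(c\blacktriangleright((x\otimes y)\blacktriangleright m))\xrightarrow{\mathrm{ev}_{c,(x\otimes y)\blacktriangleright m}}(x\otimes y)\blacktriangleright m$, i.e. the lax $\triangleright$-module structure conjugated to the strong $\blacktriangleright$-module structure of ${-}\blacktriangleright m$. For $x,y,z\in\mathcal C$ the morphisms $\delta^{\mathrm r}_{x,y,z}\colon(x\odot y)\otimes z\to x\odot(y\otimes z)$ and $\delta^{\mathrm l}_{x,y,z}\colon x\otimes(y\odot z)\to(x\otimes y)\odot z$ are the module distributors of the regular module. *)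

(* Defs.v *)
Set Implicit Arguments.
Unset Strict Implicit.
Unset Printing Implicit Defensive.

Declare Scope gv_scope.
Open Scope gv_scope.

(* Composition is written in diagrammatic order: [f >> g] is "first f, then g". *)
Reserved Notation "f >> g" (at level 50, left associativity).

Record Category := {
  Ob :> Type;
  Hom : Ob -> Ob -> Type;
  idm : forall x, Hom x x;
  comp : forall x y z, Hom x y -> Hom y z -> Hom x z
    where "f >> g" := (comp f g);
  comp_idl : forall x y (f : Hom x y), idm x >> f = f;
  comp_idr : forall x y (f : Hom x y), f >> idm y = f;
  comp_assoc : forall x y z w (f : Hom x y) (g : Hom y z) (h : Hom z w),
    (f >> g) >> h = f >> (g >> h)
}.
Arguments Hom {_} _ _.
Arguments idm {_} _.
Arguments comp {_ _ _ _} _ _.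
Arguments comp_idl {_ _ _} _.
Arguments comp_idr {_ _ _} _.
Arguments comp_assoc {_ _ _ _ _} _ _ _.
Notation "f >> g" := (comp f g) : gv_scope.

Definition Op (C : Category) : Category :=
  {| Ob := Ob C;
     Hom := fun x y => @Hom C y x;
     idm := fun x => @idm C x;
     comp := fun x y z f g => @comp C z y x g f;
     comp_idl := fun x y f => comp_idr f;
     comp_idr := fun x y f => comp_idl f;
     comp_assoc := fun x y z w f g h => eq_sym (comp_assoc h g f) |}.

Record Iso (C : Category) (x y : C) := {
  iso_fwd :> Hom x y;
  iso_bwd : Hom y x;
  iso_fwdK : iso_fwd >> iso_bwd = idm x;
  iso_bwdK : iso_bwd >> iso_fwd = idm y
}.

Definition iso_id (C : Category) (x : C) : Iso x x :=
  {| iso_fwd := idm x; iso_bwd := idm x;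
     iso_fwdK := comp_idl (idm x); iso_bwdK := comp_idl (idm x) |}.

Definition iso_sym (C : Category) (x y : C) (i : Iso x y) : Iso y x :=
  {| iso_fwd := iso_bwd i; iso_bwd := iso_fwd i;
     iso_fwdK := iso_bwdK i; iso_bwdK := iso_fwdK i |}.

Definition iso_comp (C : Category) (x y z : C) (i : Iso x y) (j : Iso y z) :
  Iso x z.
Proof.
  refine {| iso_fwd := i >> j; iso_bwd := iso_bwd j >> iso_bwd i |}.
  - rewrite comp_assoc, <- (comp_assoc j), iso_fwdK, comp_idl.
    apply iso_fwdK.
  - rewrite comp_assoc, <- (comp_assoc (iso_bwd i)), iso_bwdK, comp_idl.
    apply iso_bwdK.
Defined.

Definition iso_unop (C : Category) (x y : C) (i : @Iso (Op C) x y) :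
  @Iso C y x :=
  {| iso_fwd := (iso_fwd i : @Hom C y x);
     iso_bwd := (iso_bwd i : @Hom C x y);
     iso_fwdK := iso_bwdK i;
     iso_bwdK := iso_fwdK i |}.

Record Functor (C D : Category) := {
  fob :> C -> D;
  fmap : forall x y, Hom x y -> Hom (fob x) (fob y);
  fmap_id : forall x, fmap (idm x) = idm (fob x);
  fmap_comp : forall x y z (f : Hom x y) (g : Hom y z),
    fmap (f >> g) = fmap f >> fmap g
}.
Arguments fmap {_ _} _ {_ _} _.

Definition functor_id (C : Category) : Functor C C :=
  {| fob := fun x => x;
     fmap := fun x y f => f;
     fmap_id := fun x => eq_refl;
     fmap_comp := fun x y z f g => eq_refl |}.

Definition functor_comp (C D E : Category) (F : Functor C D) (H : Functor D E) :
  Functor C E.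
Proof.
  refine {| fob := fun x => H (F x); fmap := fun x y f => fmap H (fmap F f) |}.
  - intros x. rewrite !fmap_id. reflexivity.
  - intros x y z f g. rewrite !fmap_comp. reflexivity.
Defined.

Definition fmap_iso (C D : Category) (F : Functor C D) (x y : C) (i : Iso x y) :
  Iso (F x) (F y).
Proof.
  refine {| iso_fwd := fmap F i; iso_bwd := fmap F (iso_bwd i) |}.
  - rewrite <- fmap_comp, iso_fwdK. apply fmap_id.
  - rewrite <- fmap_comp, iso_bwdK. apply fmap_id.
Defined.

Record NatIso (C D : Category) (F H : Functor C D) := {
  ni_iso :> forall x, Iso (F x) (H x);
  ni_nat : forall x y (f : Hom x y), fmap F f >> ni_iso y = ni_iso x >> fmap H f
}.

Record Equivalence (C D : Category) (F : Functor C D) := {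
  eqv_inv : Functor D C;
  eqv_unit : NatIso (functor_id C) (functor_comp F eqv_inv);
  eqv_counit : NatIso (functor_comp eqv_inv F) (functor_id D)
}.

Record RightAdjoint (C D : Category) (L : Functor C D) := {
  radj :> Functor D C;
  adj_unit : forall x, Hom x (radj (L x));
  adj_counit : forall y, Hom (L (radj y)) y;
  adj_unit_nat : forall x x' (f : Hom x x'),
    f >> adj_unit x' = adj_unit x >> fmap radj (fmap L f);
  adj_counit_nat : forall y y' (g : Hom y y'),
    fmap L (fmap radj g) >> adj_counit y' = adj_counit y >> g;
  adj_triangle_l : forall x,
    fmap L (adj_unit x) >> adj_counit (L x) = idm (L x);
  adj_triangle_r : forall y,
    adj_unit (radj y) >> fmap radj (adj_counit y) = idm (radj y)
}.

Definition transpose (C D : Category) (L : Functor C D) (A : RightAdjoint L)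
  (x : C) (y : D) (f : Hom (L x) y) : Hom x (A y) :=
  adj_unit A x >> fmap A f.

Definition untranspose (C D : Category) (L : Functor C D) (A : RightAdjoint L)
  (x : C) (y : D) (h : Hom x (A y)) : Hom (L x) y :=
  fmap L h >> adj_counit A y.

Lemma transposeK (C D : Category) (L : Functor C D) (A : RightAdjoint L)
  (x : C) (y : D) (f : Hom (L x) y) : untranspose (transpose A f) = f.
Proof.
  unfold untranspose, transpose.
  rewrite fmap_comp, comp_assoc, adj_counit_nat, <- comp_assoc, adj_triangle_l.
  apply comp_idl.
Qed.

Lemma untransposeK (C D : Category) (L : Functor C D) (A : RightAdjoint L)
  (x : C) (y : D) (h : Hom x (A y)) : transpose A (untranspose h) = h.
Proof.
  unfold untranspose, transpose.
  rewrite fmap_comp, <- comp_assoc, <- adj_unit_nat, comp_assoc, adj_triangle_r.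
  apply comp_idr.
Qed.

Lemma untranspose_inj (C D : Category) (L : Functor C D) (A : RightAdjoint L)
  (x : C) (y : D) (h k : Hom x (A y)) :
  untranspose h = untranspose k -> h = k.
Proof.
  intros e. rewrite <- (untransposeK h), e. apply untransposeK.
Qed.

Lemma untranspose_compl (C D : Category) (L : Functor C D) (A : RightAdjoint L)
  (x x' : C) (y : D) (f : Hom x' x) (h : Hom x (A y)) :
  untranspose (f >> h) = fmap L f >> untranspose h.
Proof.
  unfold untranspose. rewrite fmap_comp. apply comp_assoc.
Qed.

Lemma untranspose_compr (C D : Category) (L : Functor C D) (A : RightAdjoint L)
  (x : C) (y y' : D) (h : Hom x (A y)) (g : Hom y y') :
  untranspose (h >> fmap A g) = untranspose h >> g.
Proof.
  unfold untranspose. rewrite fmap_comp, !comp_assoc, adj_counit_nat.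
  reflexivity.
Qed.

Lemma untranspose_id (C D : Category) (L : Functor C D) (A : RightAdjoint L)
  (y : D) : untranspose (idm (A y)) = adj_counit A y.
Proof.
  unfold untranspose. rewrite fmap_id. apply comp_idl.
Qed.

(* A natural bijection Hom (L x) y = Hom x (R y) yields an adjunction, with
   unit and counit the images of the identities. *)
Definition adjoint_of_bijection (C D : Category) (L : Functor C D)
  (R : Functor D C)
  (phi : forall x y, Hom (L x) y -> Hom x (R y))
  (psi : forall x y, Hom x (R y) -> Hom (L x) y)
  (phiK : forall x y (f : Hom (L x) y), psi x y (phi x y f) = f)
  (psiK : forall x y (h : Hom x (R y)), phi x y (psi x y h) = h)
  (phi_l : forall x x' y (f : Hom x' x) (g : Hom (L x) y),
     phi x' y (fmap L f >> g) = f >> phi x y g)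
  (phi_r : forall x y y' (f : Hom (L x) y) (g : Hom y y'),
     phi x y' (f >> g) = phi x y f >> fmap R g) :
  RightAdjoint L.
Proof.
  refine {| radj := R;
            adj_unit := fun x => phi x (L x) (idm (L x));
            adj_counit := fun y => psi (R y) y (idm (R y)) |}.
  - intros x x' f. rewrite <- phi_l, <- phi_r, comp_idl, comp_idr. reflexivity.
  - intros y y' g. rewrite <- (phiK _ _ (_ >> psi _ _ _)).
    rewrite <- (phiK _ _ (psi _ _ _ >> g)), phi_l, phi_r, !psiK.
    rewrite comp_idl, comp_idr. reflexivity.
  - intros x. rewrite <- (phiK _ _ (_ >> _)), phi_l, psiK, comp_idr.
    apply phiK.
  - intros y. rewrite <- phi_r, comp_idl. apply psiK.
Defined.

Arguments adjoint_of_bijection {C D} L R phi psi _ _ _ _.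

Record Bifunctor (C D E : Category) := {
  bob :> C -> D -> E;
  bmap : forall c c' d d', Hom c c' -> Hom d d' -> Hom (bob c d) (bob c' d');
  bmap_id : forall c d, bmap (idm c) (idm d) = idm (bob c d);
  bmap_comp : forall c c' c'' d d' d'' (f : Hom c c') (f' : Hom c' c'')
    (g : Hom d d') (g' : Hom d' d''),
    bmap (f >> f') (g >> g') = bmap f g >> bmap f' g'
}.
Arguments bmap {_ _ _} _ {_ _ _ _} _ _.

Definition bif_l (C D E : Category) (B : Bifunctor C D E) (c : C) :
  Functor D E.
Proof.
  refine {| fob := fun d => B c d; fmap := fun d d' g => bmap B (idm c) g |}.
  - intros d. apply bmap_id.
  - intros d d' d'' g g'. rewrite <- bmap_comp, comp_idl. reflexivity.
Defined.

Definition bif_r (C D E : Category) (B : Bifunctor C D E) (d : D) :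
  Functor C E.
Proof.
  refine {| fob := fun c => B c d; fmap := fun c c' f => bmap B f (idm d) |}.
  - intros c. apply bmap_id.
  - intros c c' c'' f f'. rewrite <- bmap_comp, comp_idl. reflexivity.
Defined.

Definition bmap_iso (C D E : Category) (B : Bifunctor C D E)
  (c c' : C) (d d' : D) (i : Iso c c') (j : Iso d d') :
  Iso (B c d) (B c' d').
Proof.
  refine {| iso_fwd := bmap B i j; iso_bwd := bmap B (iso_bwd i) (iso_bwd j) |}.
  - rewrite <- bmap_comp, !iso_fwdK. apply bmap_id.
  - rewrite <- bmap_comp, !iso_bwdK. apply bmap_id.
Defined.

Record MonoidalCategory := {
  mon_cat :> Category;
  tensor : Bifunctor mon_cat mon_cat mon_cat;
  mon_unit : mon_cat;
  mon_assoc : forall x y z,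
    Iso (tensor (tensor x y) z) (tensor x (tensor y z));
  mon_lunit : forall x, Iso (tensor mon_unit x) x;
  mon_runit : forall x, Iso (tensor x mon_unit) x;
  mon_assoc_nat : forall x x' y y' z z'
    (f : Hom x x') (g : Hom y y') (h : Hom z z'),
    bmap tensor (bmap tensor f g) h >> mon_assoc x' y' z'
    = mon_assoc x y z >> bmap tensor f (bmap tensor g h);
  mon_lunit_nat : forall x x' (f : Hom x x'),
    bmap tensor (idm mon_unit) f >> mon_lunit x' = mon_lunit x >> f;
  mon_runit_nat : forall x x' (f : Hom x x'),
    bmap tensor f (idm mon_unit) >> mon_runit x' = mon_runit x >> f;
  mon_pentagon : forall x y z w,
    mon_assoc (tensor x y) z w >> mon_assoc x y (tensor z w)
    = bmap tensor (mon_assoc x y z) (idm w)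
      >> mon_assoc x (tensor y z) w
      >> bmap tensor (idm x) (mon_assoc y z w);
  mon_triangle : forall x y,
    mon_assoc x mon_unit y >> bmap tensor (idm x) (mon_lunit y)
    = bmap tensor (mon_runit x) (idm y)
}.

Notation "x ⊗ y" := (tensor _ x y) (at level 40, left associativity) : gv_scope.
Notation "f ⊗₁ g" := (bmap (tensor _) f g)
  (at level 40, left associativity) : gv_scope.

(* [dual y] represents the presheaf x |-> Hom (x ⊗ y) K. *)
Record DualRepresentation (C : MonoidalCategory) (K : C) := {
  dual : C -> C;
  curry : forall x y : C, Hom (x ⊗ y) K -> Hom x (dual y);
  uncurry : forall x y : C, Hom x (dual y) -> Hom (x ⊗ y) K;
  curryK : forall x y (f : Hom (x ⊗ y) K), uncurry (curry f) = f;
  uncurryK : forall x y (h : Hom x (dual y)), curry (uncurry h) = h;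
  curry_nat : forall x x' y (f : Hom x' x) (g : Hom (x ⊗ y) K),
    curry ((f ⊗₁ idm y) >> g) = f >> curry g
}.

Lemma uncurry_nat (C : MonoidalCategory) (K : C) (d : DualRepresentation K)
  (x x' y : C) (f : Hom x' x) (h : Hom x (dual d y)) :
  uncurry (f >> h) = (f ⊗₁ idm y) >> uncurry h.
Proof.
  rewrite <- (curryK d (_ >> uncurry h)), curry_nat, uncurryK. reflexivity.
Qed.

(* The unique arrow making the representing bijection natural in [y]. *)
Definition dual_map (C : MonoidalCategory) (K : C) (d : DualRepresentation K)
  (y y' : C) (f : Hom y y') : Hom (dual d y') (dual d y) :=
  curry d ((idm (dual d y') ⊗₁ f) >> uncurry (idm (dual d y'))).

Lemma uncurry_dual_map (C : MonoidalCategory) (K : C)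
  (d : DualRepresentation K) (x y y' : C) (f : Hom y y')
  (h : Hom x (dual d y')) :
  uncurry (h >> dual_map d f) = (idm x ⊗₁ f) >> uncurry h.
Proof.
  rewrite uncurry_nat. unfold dual_map. rewrite curryK, <- comp_assoc.
  rewrite <- bmap_comp, comp_idl, comp_idr.
  transitivity ((idm x ⊗₁ f) >> uncurry (h >> idm (dual d y'))).
  - rewrite uncurry_nat, <- comp_assoc, <- bmap_comp, comp_idl, comp_idr.
    reflexivity.
  - rewrite comp_idr. reflexivity.
Qed.

Definition dual_functor (C : MonoidalCategory) (K : C)
  (d : DualRepresentation K) : Functor (Op C) C.
Proof.
  refine {| fob := dual d : Op C -> C;
            fmap := fun (x y : Op C) (f : @Hom (Op C) x y) =>
              dual_map d (f : @Hom C y x) |}.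
  - intros x. unfold dual_map. cbn. rewrite bmap_id, comp_idl. apply uncurryK.
  - intros x y z f g. cbn in *.
    rewrite <- (uncurryK (dual_map d (g >> f))).
    rewrite <- (uncurryK (dual_map d f >> dual_map d g)). f_equal.
    rewrite uncurry_dual_map. unfold dual_map at 1 2. rewrite !curryK.
    rewrite <- comp_assoc, <- bmap_comp, comp_idl. reflexivity.
Defined.

Record GVCategory := {
  gv_mon :> MonoidalCategory;
  gv_K : gv_mon;
  gv_dual : DualRepresentation gv_K;
  gv_equiv : Equivalence (dual_functor gv_dual)
}.

Definition G (C : GVCategory) (x : C) : C := dual (gv_dual C) x.

Definition gcurry (C : GVCategory) (x y : C) (f : Hom (x ⊗ y) (gv_K C)) :
  Hom x (G y) := curry (gv_dual C) f.

Definition guncurry (C : GVCategory) (x y : C) (h : Hom x (G y)) :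
  Hom (x ⊗ y) (gv_K C) := uncurry (d := gv_dual C) h.

Definition G_map (C : GVCategory) (x y : C) (f : Hom x y) : Hom (G y) (G x) :=
  dual_map (gv_dual C) f.

Definition Ginv (C : GVCategory) (x : C) : C := eqv_inv (gv_equiv C) x.

Definition Ginv_map (C : GVCategory) (x y : C) (f : Hom x y) :
  Hom (Ginv y) (Ginv x) :=
  fmap (eqv_inv (gv_equiv C)) f.

Definition GGinv (C : GVCategory) (x : C) : Iso (G (Ginv x)) x :=
  eqv_counit (gv_equiv C) x.

Definition GinvG (C : GVCategory) (x : C) : Iso (Ginv (G x)) x :=
  iso_unop (eqv_unit (gv_equiv C) x).

(* The inverse of the bijection [G_map] on Hom sets. *)
Definition G_preimage (C : GVCategory) (x y : C) (h : Hom (G y) (G x)) :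
  Hom x y :=
  iso_bwd (GinvG x) >> Ginv_map h >> GinvG y.

Lemma gcurryK (C : GVCategory) (x y : C) (f : Hom (x ⊗ y) (gv_K C)) :
  guncurry (gcurry f) = f.
Proof. apply curryK. Qed.

Lemma guncurryK (C : GVCategory) (x y : C) (h : Hom x (G y)) :
  gcurry (guncurry h) = h.
Proof. apply uncurryK. Qed.

Lemma guncurry_inj (C : GVCategory) (x y : C) (h k : Hom x (G y)) :
  guncurry h = guncurry k -> h = k.
Proof.
  intros e. rewrite <- (guncurryK h), e. apply guncurryK.
Qed.

Lemma gcurry_nat (C : GVCategory) (x x' y : C) (f : Hom x' x)
  (g : Hom (x ⊗ y) (gv_K C)) : gcurry ((f ⊗₁ idm y) >> g) = f >> gcurry g.
Proof. apply curry_nat. Qed.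

Lemma guncurry_nat (C : GVCategory) (x x' y : C) (f : Hom x' x)
  (h : Hom x (G y)) : guncurry (f >> h) = (f ⊗₁ idm y) >> guncurry h.
Proof. apply uncurry_nat. Qed.

Lemma guncurry_G_map (C : GVCategory) (x y y' : C) (f : Hom y y')
  (h : Hom x (G y')) :
  guncurry (h >> G_map f) = (idm x ⊗₁ f) >> guncurry h.
Proof. apply uncurry_dual_map. Qed.

Lemma G_map_id (C : GVCategory) (x : C) : G_map (idm x) = idm (G x).
Proof. exact (fmap_id (dual_functor (gv_dual C)) x). Qed.

Lemma G_map_comp (C : GVCategory) (x y z : C) (f : Hom x y) (g : Hom y z) :
  G_map (f >> g) = G_map g >> G_map f.
Proof. exact (@fmap_comp _ _ (dual_functor (gv_dual C)) z y x g f). Qed.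

Lemma Ginv_map_id (C : GVCategory) (x : C) : Ginv_map (idm x) = idm (Ginv x).
Proof. exact (fmap_id (eqv_inv (gv_equiv C)) x). Qed.

Lemma Ginv_map_comp (C : GVCategory) (x y z : C) (f : Hom x y) (g : Hom y z) :
  Ginv_map (f >> g) = Ginv_map g >> Ginv_map f.
Proof. exact (fmap_comp (eqv_inv (gv_equiv C)) f g). Qed.

Lemma GGinv_nat (C : GVCategory) (x y : C) (f : Hom x y) :
  G_map (Ginv_map f) >> GGinv y = GGinv x >> f.
Proof. exact (ni_nat (eqv_counit (gv_equiv C)) f). Qed.

Lemma GinvG_nat (C : GVCategory) (x y : C) (f : Hom x y) :
  Ginv_map (G_map f) >> GinvG y = GinvG x >> f.
Proof.
  exact (eq_sym (@ni_nat _ _ _ _ (eqv_unit (gv_equiv C)) y x f)).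
Qed.

Lemma iso_cancel_l (C : Category) (x y z : C) (i : Iso x y) (f g : Hom y z) :
  i >> f = i >> g -> f = g.
Proof.
  intros e. rewrite <- (comp_idl f), <- (comp_idl g), <- (iso_bwdK i).
  rewrite !comp_assoc, e. reflexivity.
Qed.

Lemma iso_cancel_r (C : Category) (x y z : C) (i : Iso y z) (f g : Hom x y) :
  f >> i = g >> i -> f = g.
Proof.
  intros e. rewrite <- (comp_idr f), <- (comp_idr g), <- (iso_fwdK i).
  rewrite <- !comp_assoc, e. reflexivity.
Qed.

Lemma G_preimageK (C : GVCategory) (x y : C) (f : Hom x y) :
  G_preimage (G_map f) = f.
Proof.
  unfold G_preimage. rewrite comp_assoc, GinvG_nat, <- comp_assoc, iso_bwdK.
  apply comp_idl.
Qed.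

Lemma Ginv_map_inj (C : GVCategory) (x y : C) (f g : Hom x y) :
  Ginv_map f = Ginv_map g -> f = g.
Proof.
  intros e. apply ((iso_cancel_l (i := GGinv x))). rewrite <- !GGinv_nat, e.
  reflexivity.
Qed.

Lemma G_mapK (C : GVCategory) (x y : C) (h : Hom (G y) (G x)) :
  G_map (G_preimage h) = h.
Proof.
  apply Ginv_map_inj, ((iso_cancel_r (i := GinvG y))). rewrite GinvG_nat.
  unfold G_preimage. rewrite comp_assoc, <- !comp_assoc, iso_fwdK, comp_idl.
  reflexivity.
Qed.

Lemma G_map_inj (C : GVCategory) (x y : C) (f g : Hom x y) :
  G_map f = G_map g -> f = g.
Proof.
  intros e. rewrite <- (G_preimageK f), e. apply G_preimageK.
Qed.

Definition odot (C : GVCategory) : Bifunctor C C C.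
Proof.
  refine {| bob := fun x y : C => Ginv (G y ⊗ G x);
            bmap := fun (x x' y y' : C) (f : Hom x x') (g : Hom y y') =>
              Ginv_map (G_map g ⊗₁ G_map f) |}.
  - intros x y. rewrite !G_map_id, bmap_id. apply Ginv_map_id.
  - intros x x' x'' y y' y'' f f' g g'.
    rewrite !G_map_comp, bmap_comp. apply Ginv_map_comp.
Defined.

Notation "x ⊙ y" := (odot _ x y) (at level 40, left associativity) : gv_scope.
Notation "f ⊙₁ g" := (bmap (odot _) f g)
  (at level 40, left associativity) : gv_scope.

(* [Ginv] applied to the associator (G z ⊗ G y) ⊗ G x -> G z ⊗ (G y ⊗ G x),
   after replacing G (y ⊙ z) by G z ⊗ G y and G (x ⊙ y) by G y ⊗ G x. *)
Definition odot_assoc (C : GVCategory) (x y z : C) :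
  Iso ((x ⊙ y) ⊙ z) (x ⊙ (y ⊙ z)) :=
  iso_unop (fmap_iso (eqv_inv (gv_equiv C))
    (iso_comp
      (iso_comp (bmap_iso (tensor C) (GGinv (G z ⊗ G y)) (iso_id (G x)))
                (mon_assoc (G z) (G y) (G x)))
      (bmap_iso (tensor C) (iso_id (G z)) (iso_sym (GGinv (G y ⊗ G x)))))).

Record ModuleCategory (C : MonoidalCategory) := {
  mod_cat :> Category;
  act : Bifunctor C mod_cat mod_cat;
  act_assoc : forall (x y : C) (m : mod_cat), Iso (act (x ⊗ y) m) (act x (act y m));
  act_unit : forall m : mod_cat, Iso (act (mon_unit C) m) m;
  act_assoc_nat : forall (x x' y y' : C) (m m' : mod_cat)
    (f : Hom x x') (g : Hom y y') (h : Hom m m'),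
    bmap act (f ⊗₁ g) h >> act_assoc x' y' m'
    = act_assoc x y m >> bmap act f (bmap act g h);
  act_unit_nat : forall (m m' : mod_cat) (h : Hom m m'),
    bmap act (idm (mon_unit C)) h >> act_unit m' = act_unit m >> h;
  act_pentagon : forall (x y z : C) (m : mod_cat),
    act_assoc (x ⊗ y) z m >> act_assoc x y (act z m)
    = bmap act (mon_assoc x y z) (idm m)
      >> act_assoc x (y ⊗ z) m
      >> bmap act (idm x) (act_assoc y z m);
  act_triangle : forall (x : C) (m : mod_cat),
    act_assoc x (mon_unit C) m >> bmap act (idm x) (act_unit m)
    = bmap act (mon_runit x) (idm m)
}.

Arguments act_assoc {_} _ _ _ _.
Arguments act_unit {_} _ _.

Record GVModule (C : GVCategory) := {
  gvm_mod :> ModuleCategory C;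
  gvm_ladj : forall c : C, inhabited (RightAdjoint (bif_l (act gvm_mod) c));
  gvm_radj : forall m : gvm_mod,
    inhabited (RightAdjoint (bif_r (act gvm_mod) m));
  (* The chosen right adjoint of [G c ▷ -], that is, [c ▶ -]. *)
  gvm_adj : forall c : C, RightAdjoint (bif_l (act gvm_mod) (G c))
}.

Notation "c ▷ m" := (act _ c m) (at level 40, left associativity) : gv_scope.
Notation "f ▷₁ g" := (bmap (act _) f g)
  (at level 40, left associativity) : gv_scope.

(* [f ▶ m] is the arrow corresponding under the adjunctions, by the Yoneda
   lemma, to [G f ▷ -]. *)
Definition bact_map (C : GVCategory) (M : GVModule C) (c c' : C) (m m' : M)
  (f : Hom c c') (g : Hom m m') : Hom (gvm_adj M c m) (gvm_adj M c' m') :=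
  transpose (gvm_adj M c')
    (y := m')
    ((G_map f ▷₁ idm (gvm_adj M c m)) >> adj_counit (gvm_adj M c) m >> g).

Definition bact (C : GVCategory) (M : GVModule C) : Bifunctor C M M.
Proof.
  refine {| bob := fun (c : C) (m : M) => gvm_adj M c m;
            bmap := fun c c' m m' f g => bact_map f g |}.
  - intros c m. unfold bact_map. rewrite G_map_id, bmap_id, comp_idl, comp_idr.
    rewrite <- untranspose_id. apply untransposeK.
  - intros c c' c'' m m' m'' f f' g g'. apply untranspose_inj.
    rewrite untranspose_compl. unfold bact_map. rewrite !transposeK. cbn.
    rewrite G_map_comp, <- !comp_assoc, <- bmap_comp, comp_idl, comp_idr.
    set (t := transpose _ _).
    replace (G_map f' ▷₁ t) with
      ((G_map f' ▷₁ idm _) >> (idm (G c') ▷₁ t))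
      by (rewrite <- bmap_comp, comp_idl, comp_idr; reflexivity).
    rewrite (comp_assoc _ _ (adj_counit (gvm_adj M c') m')).
    change ((idm (G c') ▷₁ t) >> adj_counit (gvm_adj M c') m')
      with (untranspose t).
    unfold t. rewrite transposeK, <- !comp_assoc, <- bmap_comp, comp_idl.
    reflexivity.
Defined.

Notation "c ▶ m" := (bact _ c m) (at level 40, left associativity) : gv_scope.
Notation "f ▶₁ g" := (bmap (bact _) f g)
  (at level 40, left associativity) : gv_scope.

Definition ev (C : GVCategory) (M : GVModule C) (c : C) (m : M) :
  Hom (G c ▷ (c ▶ m)) m :=
  adj_counit (gvm_adj M c) m.

Definition coev (C : GVCategory) (M : GVModule C) (c : C) (m : M) :
  Hom m (c ▶ (G c ▷ m)) :=
  adj_unit (gvm_adj M c) m.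

Arguments ev {_} _ _ _.
Arguments coev {_} _ _ _.

(* The module constraint corresponds by the Yoneda lemma to
   Hom ((G y ⊗ G x) ▷ n) m = Hom (G y ▷ (G x ▷ n)) m. *)
Definition bact_assoc_fwd (C : GVCategory) (M : GVModule C) (x y : C) (m : M) :
  Hom ((x ⊙ y) ▶ m) (x ▶ (y ▶ m)) :=
  transpose (gvm_adj M x) (y := y ▶ m)
    (transpose (gvm_adj M y) (y := m)
      (iso_bwd (act_assoc M (G y) (G x) ((x ⊙ y) ▶ m))
       >> (iso_bwd (GGinv (G y ⊗ G x)) ▷₁ idm ((x ⊙ y) ▶ m))
       >> ev M (x ⊙ y) m)).

Definition bact_assoc_bwd (C : GVCategory) (M : GVModule C) (x y : C) (m : M) :
  Hom (x ▶ (y ▶ m)) ((x ⊙ y) ▶ m) :=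
  transpose (gvm_adj M (x ⊙ y)) (y := m)
    ((GGinv (G y ⊗ G x) ▷₁ idm (x ▶ (y ▶ m)))
     >> act_assoc M (G y) (G x) (x ▶ (y ▶ m))
     >> (idm (G y) ▷₁ ev M x (y ▶ m))
     >> ev M y m).

Lemma bmap_swap (C D E : Category) (B : Bifunctor C D E) (c c' : C) (d d' : D)
  (f : Hom c c') (g : Hom d d') :
  bmap B (idm c) g >> bmap B f (idm d') = bmap B f (idm d) >> bmap B (idm c') g.
Proof.
  rewrite <- !bmap_comp, !comp_idl, !comp_idr. reflexivity.
Qed.

Lemma act_assoc_natV (C : MonoidalCategory) (M : ModuleCategory C)
  (x x' y y' : C) (m m' : M) (f : Hom x x') (g : Hom y y') (h : Hom m m') :
  (f ▷₁ (g ▷₁ h)) >> iso_bwd (act_assoc M x' y' m')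
  = iso_bwd (act_assoc M x y m) >> ((f ⊗₁ g) ▷₁ h).
Proof.
  apply (iso_cancel_l (i := act_assoc M x y m)).
  rewrite <- !comp_assoc, <- act_assoc_nat, iso_fwdK, comp_idl, comp_assoc.
  rewrite iso_fwdK. apply comp_idr.
Qed.

Lemma bact_assoc_untranspose (C : GVCategory) (M : GVModule C) (x y : C) (m n : M)
  (h : Hom n ((x ⊙ y) ▶ m)) :
  untranspose (A := gvm_adj M y) (y := m)
    (untranspose (A := gvm_adj M x) (y := y ▶ m) (h >> bact_assoc_fwd x y m))
  = iso_bwd (act_assoc M (G y) (G x) n)
    >> (iso_bwd (GGinv (G y ⊗ G x)) ▷₁ idm n)
    >> untranspose (A := gvm_adj M (x ⊙ y)) (y := m) h.
Proof.
  unfold bact_assoc_fwd. rewrite !untranspose_compl, !transposeK. cbn.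
  rewrite <- !comp_assoc, act_assoc_natV, bmap_id, (comp_assoc _ _ (_ ▷₁ _)).
  rewrite bmap_swap. unfold untranspose, ev. rewrite !comp_assoc. reflexivity.
Qed.

Lemma bact_assoc_bwdK (C : GVCategory) (M : GVModule C) (x y : C) (m : M) :
  bact_assoc_bwd x y m >> bact_assoc_fwd x y m = idm (x ▶ (y ▶ m)).
Proof.
  apply (untranspose_inj (A := gvm_adj M x) (y := y ▶ m)).
  apply (untranspose_inj (A := gvm_adj M y) (y := m)).
  rewrite bact_assoc_untranspose. unfold bact_assoc_bwd.
  rewrite transposeK, <- !comp_assoc.
  rewrite (comp_assoc _ _ (GGinv _ ▷₁ _)), <- bmap_comp, iso_bwdK, comp_idl.
  rewrite bmap_id, comp_idr, iso_bwdK, comp_idl.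
  etransitivity;
    [|apply f_equal, eq_sym, (untranspose_id (gvm_adj M x) (y ▶ m))].
  reflexivity.
Qed.

Definition bact_assoc (C : GVCategory) (M : GVModule C) (x y : C) (m : M) :
  Iso ((x ⊙ y) ▶ m) (x ▶ (y ▶ m)).
Proof.
  refine {| iso_fwd := bact_assoc_fwd x y m; iso_bwd := bact_assoc_bwd x y m;
            iso_bwdK := bact_assoc_bwdK x y m |}.
  apply (untranspose_inj (A := gvm_adj M (x ⊙ y)) (y := m)).
  apply (iso_cancel_l (i := iso_comp
    (iso_sym (act_assoc M (G y) (G x) ((x ⊙ y) ▶ m)))
    (bmap_iso (act M) (iso_sym (GGinv (G y ⊗ G x))) (iso_id _)))).
  etransitivity; [symmetry; apply bact_assoc_untranspose|].
  etransitivity; [|apply bact_assoc_untranspose].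
  rewrite comp_assoc, bact_assoc_bwdK, comp_idl, comp_idr. reflexivity.
Defined.
Arguments bact_assoc {_} _ _ _ _.

Definition regular_mod (C : MonoidalCategory) : ModuleCategory C :=
  {| mod_cat := C;
     act := tensor C;
     act_assoc := @mon_assoc C;
     act_unit := @mon_lunit C;
     act_assoc_nat := @mon_assoc_nat C;
     act_unit_nat := @mon_lunit_nat C;
     act_pentagon := @mon_pentagon C;
     act_triangle := @mon_triangle C |}.

(* Hom (a ⊗ y) z = Hom (G z) (G (a ⊗ y)) = Hom (G z ⊗ (a ⊗ y)) K
   = Hom ((G z ⊗ a) ⊗ y) K = Hom (G z ⊗ a) (G y) = Hom y (Ginv (G z ⊗ a)). *)
Definition hom_l (C : GVCategory) (a y z : C) (f : Hom (a ⊗ y) z) :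
  Hom y (Ginv (G z ⊗ a)) :=
  G_preimage (GGinv (G z ⊗ a)
    >> gcurry
         (mon_assoc (G z) a y >> guncurry (G_map f))).

Definition hom_l_inv (C : GVCategory) (a y z : C)
  (h : Hom y (Ginv (G z ⊗ a))) : Hom (a ⊗ y) z :=
  G_preimage (gcurry
    (iso_bwd (mon_assoc (G z) a y)
     >> guncurry (iso_bwd (GGinv (G z ⊗ a)) >> G_map h))).

Lemma hom_lK (C : GVCategory) (a y z : C) (f : Hom (a ⊗ y) z) :
  hom_l_inv (hom_l f) = f.
Proof.
  unfold hom_l_inv, hom_l. rewrite G_mapK, <- comp_assoc, iso_bwdK, comp_idl.
  rewrite gcurryK, <- comp_assoc, iso_bwdK, comp_idl, guncurryK.
  apply G_preimageK.
Qed.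

Lemma hom_l_invK (C : GVCategory) (a y z : C) (h : Hom y (Ginv (G z ⊗ a))) :
  hom_l (hom_l_inv h) = h.
Proof.
  unfold hom_l_inv, hom_l. rewrite G_mapK, gcurryK, <- comp_assoc, iso_fwdK.
  rewrite comp_idl, guncurryK, <- comp_assoc, iso_fwdK, comp_idl.
  apply G_preimageK.
Qed.

Lemma hom_l_natl (C : GVCategory) (a y y' z : C) (f : Hom y' y)
  (g : Hom (a ⊗ y) z) : hom_l ((idm a ⊗₁ f) >> g) = f >> hom_l g.
Proof.
  apply G_map_inj. rewrite G_map_comp. unfold hom_l. rewrite !G_mapK, comp_assoc.
  f_equal. apply guncurry_inj. rewrite guncurry_G_map, !gcurryK.
  rewrite G_map_comp, guncurry_G_map, <- !comp_assoc, <- mon_assoc_nat, bmap_id.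
  reflexivity.
Qed.

Lemma hom_l_natr (C : GVCategory) (a y z z' : C) (f : Hom (a ⊗ y) z)
  (g : Hom z z') : hom_l (f >> g) = hom_l f >> Ginv_map (G_map g ⊗₁ idm a).
Proof.
  apply G_map_inj. rewrite G_map_comp. unfold hom_l.
  rewrite !G_mapK, <- comp_assoc, GGinv_nat, comp_assoc. f_equal.
  apply guncurry_inj. rewrite guncurry_nat, !gcurryK.
  rewrite <- comp_assoc, mon_assoc_nat, bmap_id, comp_assoc, G_map_comp.
  rewrite guncurry_nat. reflexivity.
Qed.

Definition tensor_radj_l (C : GVCategory) (a : C) :
  RightAdjoint (bif_l (tensor C) a).
Proof.
  unshelve refine (adjoint_of_bijection (bif_l (tensor C) a)
    {| fob := fun z : C => Ginv (G z ⊗ a) : C;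
       fmap := fun (z z' : C) (g : Hom z z') => Ginv_map (G_map g ⊗₁ idm a) |}
    (@hom_l C a) (@hom_l_inv C a) (@hom_lK C a) (@hom_l_invK C a)
    (fun y y' z => @hom_l_natl C a y y' z) (@hom_l_natr C a)).
  - intros z. rewrite G_map_id, bmap_id. apply Ginv_map_id.
  - intros z z' z'' g g'.
    rewrite <- Ginv_map_comp, <- bmap_comp, comp_idl, <- G_map_comp.
    reflexivity.
Defined.

(* Hom (x ⊗ m) z = Hom (x ⊗ m) (G (Ginv z)) = Hom ((x ⊗ m) ⊗ Ginv z) K
   = Hom (x ⊗ (m ⊗ Ginv z)) K = Hom x (G (m ⊗ Ginv z)). *)
Definition hom_r (C : GVCategory) (m x z : C) (f : Hom (x ⊗ m) z) :
  Hom x (G (m ⊗ Ginv z)) :=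
  gcurry
    (iso_bwd (mon_assoc x m (Ginv z))
     >> guncurry (f >> iso_bwd (GGinv z))).

Definition hom_r_inv (C : GVCategory) (m x z : C)
  (h : Hom x (G (m ⊗ Ginv z))) : Hom (x ⊗ m) z :=
  gcurry
    (mon_assoc x m (Ginv z) >> guncurry h) >> GGinv z.

Lemma GGinv_natV (C : GVCategory) (x y : C) (f : Hom x y) :
  iso_bwd (GGinv x) >> G_map (Ginv_map f) = f >> iso_bwd (GGinv y).
Proof.
  apply (iso_cancel_r (i := GGinv y)), (iso_cancel_l (i := GGinv x)).
  rewrite !comp_assoc, iso_bwdK, comp_idr, GGinv_nat, <- comp_assoc, iso_fwdK.
  apply comp_idl.
Qed.

Lemma mon_assoc_natV (C : MonoidalCategory) (x x' y y' z z' : C)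
  (f : Hom x x') (g : Hom y y') (h : Hom z z') :
  (f ⊗₁ (g ⊗₁ h)) >> iso_bwd (mon_assoc x' y' z')
  = iso_bwd (mon_assoc x y z) >> ((f ⊗₁ g) ⊗₁ h).
Proof. exact (@act_assoc_natV C (regular_mod C) x x' y y' z z' f g h). Qed.

Definition tensor_radj_r (C : GVCategory) (m : C) :
  RightAdjoint (bif_r (tensor C) m).
Proof.
  unshelve refine (adjoint_of_bijection (bif_r (tensor C) m)
    {| fob := fun z : C => G (m ⊗ Ginv z) : C;
       fmap := fun (z z' : C) (g : Hom z z') => G_map (idm m ⊗₁ Ginv_map g) |}
    (@hom_r C m) (@hom_r_inv C m) _ _ _ _).
  - intros z. rewrite Ginv_map_id, bmap_id. apply G_map_id.
  - intros z z' z'' g g'.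
    rewrite <- G_map_comp, <- bmap_comp, comp_idl, <- Ginv_map_comp.
    reflexivity.
  - intros x z f. cbn in *. unfold hom_r_inv, hom_r.
    rewrite gcurryK, <- comp_assoc, iso_fwdK, comp_idl, guncurryK, comp_assoc.
    rewrite iso_bwdK. apply comp_idr.
  - intros x z h. cbn in *. unfold hom_r_inv, hom_r.
    rewrite comp_assoc, iso_fwdK.
    rewrite (comp_idr (gcurry _)).
    rewrite gcurryK, <- comp_assoc, iso_bwdK, comp_idl. apply guncurryK.
  - intros x x' z f g. cbn in *. unfold hom_r.
    rewrite <- gcurry_nat, comp_assoc, guncurry_nat, <- !comp_assoc.
    rewrite <- mon_assoc_natV, bmap_id. reflexivity.
  - intros x z z' f g. cbn in *. unfold hom_r.
    apply guncurry_inj. rewrite guncurry_G_map, !gcurryK.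
    rewrite <- comp_assoc, mon_assoc_natV, bmap_id, comp_assoc, comp_assoc.
    rewrite <- GGinv_natV, <- comp_assoc, guncurry_G_map. reflexivity.
Defined.

(* The right adjoint of [G c ⊗ -] chosen for the regular module is the functor
   [c ⊙ -]. *)
Definition regular_adj (C : GVCategory) (c : C) :
  RightAdjoint (bif_l (tensor C) (G c)).
Proof.
  refine (adjoint_of_bijection (bif_l (tensor C) (G c)) (bif_l (odot C) c)
    (@hom_l C (G c)) (@hom_l_inv C (G c)) (@hom_lK C (G c)) (@hom_l_invK C (G c))
    (fun y y' z => @hom_l_natl C (G c) y y' z) _).
  intros y z z' f g. cbn. rewrite G_map_id. apply hom_l_natr.
Defined.

Definition regular (C : GVCategory) : GVModule C :=
  {| gvm_mod := regular_mod C;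
     gvm_ladj := fun c => inhabits (tensor_radj_l c);
     gvm_radj := fun m => inhabits (tensor_radj_r m);
     gvm_adj := fun c => regular_adj c |}.

Lemma hom_l_inv_natl (C : GVCategory) (a y y' z : C) (f : Hom y' y)
  (h : Hom y (Ginv (G z ⊗ a))) :
  hom_l_inv (f >> h) = (idm a ⊗₁ f) >> hom_l_inv h.
Proof.
  rewrite <- (hom_lK (_ >> hom_l_inv h)), hom_l_natl, hom_l_invK. reflexivity.
Qed.

Lemma regular_untranspose (C : GVCategory) (c y z : C) (h : Hom y (c ⊙ z)) :
  untranspose (A := regular_adj c) (x := y) (y := z) h = hom_l_inv h.
Proof.
  unfold untranspose. cbn. rewrite <- hom_l_inv_natl, comp_idr. reflexivity.
Qed.

Lemma regular_ev (C : GVCategory) (c z : C) :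
  ev (regular C) c z = hom_l_inv (idm (c ⊙ z)).
Proof. reflexivity. Qed.

Lemma hom_l_dinat (C : GVCategory) (a a' y z : C) (k : Hom a' a)
  (f : Hom (a ⊗ y) z) :
  hom_l ((k ⊗₁ idm y) >> f) = hom_l f >> Ginv_map (idm (G z) ⊗₁ k).
Proof.
  apply G_map_inj. rewrite G_map_comp. unfold hom_l.
  rewrite !G_mapK, <- comp_assoc, GGinv_nat, comp_assoc. f_equal.
  apply guncurry_inj. rewrite guncurry_nat, !gcurryK, G_map_comp, guncurry_G_map.
  rewrite <- !comp_assoc, mon_assoc_nat. reflexivity.
Qed.

Lemma mon_pentagonV (C : MonoidalCategory) (x y z w : C) :
  iso_bwd (mon_assoc x y (z ⊗ w)) >> iso_bwd (mon_assoc (x ⊗ y) z w)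
    >> (mon_assoc x y z ⊗₁ idm w)
  = (idm x ⊗₁ iso_bwd (mon_assoc y z w)) >> iso_bwd (mon_assoc x (y ⊗ z) w).
Proof.
  apply (iso_cancel_l
    (i := iso_comp (mon_assoc (x ⊗ y) z w) (mon_assoc x y (z ⊗ w)))).
  apply (iso_cancel_r (i := mon_assoc x (y ⊗ z) w)).
  apply (iso_cancel_r (i := bmap_iso (tensor C) (iso_id x) (mon_assoc y z w))).
  cbn. rewrite <- !comp_assoc.
  rewrite (comp_assoc (mon_assoc (x ⊗ y) z w) _ (iso_bwd (mon_assoc x y _))).
  rewrite iso_fwdK, comp_idr, iso_fwdK, comp_idl, <- mon_pentagon.
  rewrite (comp_assoc _ (iso_bwd (mon_assoc x (y ⊗ z) w))), iso_bwdK, comp_idr.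
  rewrite (comp_assoc _ (idm x ⊗₁ _)), <- bmap_comp, comp_idl, iso_bwdK, bmap_id.
  rewrite comp_idr. reflexivity.
Qed.

Lemma mon_pentagonV_conj (C : MonoidalCategory) (a b c n p q k : C)
  (t : Iso p (b ⊗ a)) (s : Iso q (c ⊗ b)) (w : Hom ((c ⊗ p) ⊗ n) k) :
  (idm c ⊗₁ iso_bwd (mon_assoc b a n))
    >> ((idm c ⊗₁ (iso_bwd t ⊗₁ idm n)) >> (iso_bwd (mon_assoc c p n) >> w))
  = iso_bwd (mon_assoc c b (a ⊗ n))
    >> ((iso_bwd s ⊗₁ idm (a ⊗ n))
        >> (iso_bwd (mon_assoc q a n)
            >> (((s ⊗₁ idm a) >> mon_assoc c b a >> (idm c ⊗₁ iso_bwd t))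
                ⊗₁ idm n >> w))).
Proof.
  rewrite <- !comp_assoc. f_equal.
  rewrite (comp_assoc _ (_ ⊗₁ (_ ⊗₁ _))), mon_assoc_natV, <- comp_assoc.
  rewrite <- mon_pentagonV, (comp_assoc _ (iso_bwd s ⊗₁ _)), <- bmap_id.
  rewrite mon_assoc_natV, !comp_assoc. do 2 f_equal.
  rewrite <- !bmap_comp, !comp_idl, <- !comp_assoc, <- bmap_comp, iso_bwdK.
  rewrite comp_idl, bmap_id, comp_idl. reflexivity.
Qed.

(* For the regular module, [▶] is [⊙] also on morphisms, and its module
   constraint is the associator of [⊙]. *)
Lemma regular_bact_map (C : GVCategory) (x x' y y' : C)
  (f : Hom x x') (g : Hom y y') :
  bmap (bact (regular C)) f g = f ⊙₁ g.
Proof.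
  assert (e : (G_map f ⊗₁ idm (x ⊙ y)) >> hom_l_inv (idm (x ⊙ y)) >> g
              = hom_l_inv (f ⊙₁ g)).
  { rewrite <- (hom_lK (_ >> _)). f_equal. cbn.
    rewrite hom_l_natr, (hom_l_dinat (G_map f)), hom_l_invK, comp_idl.
    rewrite <- Ginv_map_comp, <- bmap_comp, comp_idl, comp_idr. reflexivity. }
  apply (untranspose_inj (A := regular_adj x') (x := x ⊙ y) (y := y')).
  exact (eq_trans (transposeK (regular_adj x') _)
           (eq_trans e (eq_sym (regular_untranspose _)))).
Qed.

Lemma regular_bact_assoc (C : GVCategory) (x y z : C) :
  iso_fwd (bact_assoc (regular C) x y z) = odot_assoc x y z.
Proof.
  assert (e : iso_bwd (mon_assoc (G y) (G x) ((x ⊙ y) ⊙ z))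
      >> (iso_bwd (GGinv (G y ⊗ G x)) ⊗₁ idm ((x ⊙ y) ⊙ z))
      >> hom_l_inv (a := G (x ⊙ y)) (z := z) (idm ((x ⊙ y) ⊙ z))
    = hom_l_inv (a := G y) (z := z)
        (hom_l_inv (a := G x) (z := y ⊙ z) (odot_assoc x y z))).
  { assert (e : iso_bwd (GGinv (G (y ⊙ z) ⊗ G x))
          >> G_map (y := Ginv (G (y ⊙ z) ⊗ G x)) (odot_assoc x y z)
      = (GGinv (G z ⊗ G y) ⊗₁ idm (G x)) >> mon_assoc (G z) (G y) (G x)
        >> (idm (G z) ⊗₁ iso_bwd (GGinv (G y ⊗ G x)))
        >> iso_bwd (GGinv (G z ⊗ G (x ⊙ y)))) by exact (GGinv_natV _).
    apply G_map_inj, guncurry_inj. unfold hom_l_inv.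
    rewrite !G_map_comp, !G_mapK, <- (comp_assoc (gcurry _)), e.
    rewrite !guncurry_G_map, !gcurryK.
    rewrite (guncurry_nat (iso_bwd (GGinv (G z ⊗ G y)))), gcurryK.
    rewrite bmap_id, comp_idl, (guncurry_nat (_ >> _ >> _)).
    apply mon_pentagonV_conj. }
  apply (untranspose_inj (A := regular_adj x) (x := (x ⊙ y) ⊙ z) (y := y ⊙ z)).
  apply (untranspose_inj (A := regular_adj y) (y := z)).
  etransitivity; [apply f_equal, (transposeK (regular_adj x))|].
  etransitivity; [apply (transposeK (regular_adj y))|].
  etransitivity; [exact e|].
  etransitivity; [symmetry; apply (regular_untranspose (c := y) (z := z))|].
  apply f_equal. symmetry. apply (regular_untranspose (c := x) (z := y ⊙ z)).
Qed.

Definition delta_r (C : GVCategory) (M : GVModule C) (x y : C) (m : M) :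
  Hom ((x ⊙ y) ▷ m) (x ▶ (y ▷ m)) :=
  coev M x ((x ⊙ y) ▷ m)
  >> (idm x ▶₁ iso_bwd (act_assoc M (G x) (x ⊙ y) m))
  >> (idm x ▶₁ (ev (regular C) x y ▷₁ idm m)).

(* The (co)evaluations at c = Ginv x, with G c replaced by x along
   [GGinv x]. *)
Definition coev_Ginv (C : GVCategory) (x y : C) :
  Hom y (Ginv x ⊙ (x ⊗ y)) :=
  coev (regular C) (Ginv x) y >> (idm (Ginv x) ⊙₁ (GGinv x ⊗₁ idm y)).

Definition ev_Ginv (C : GVCategory) (M : GVModule C) (x : C) (m : M) :
  Hom (x ▷ (Ginv x ▶ m)) m :=
  (iso_bwd (GGinv x) ▷₁ idm (Ginv x ▶ m)) >> ev M (Ginv x) m.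

Arguments ev_Ginv {_} _ _ _.

Definition delta_l (C : GVCategory) (M : GVModule C) (x y : C) (m : M) :
  Hom (x ▷ (y ▶ m)) ((x ⊗ y) ▶ m) :=
  (idm x ▷₁ (coev_Ginv x y ▶₁ idm m))
  >> (idm x ▷₁ bact_assoc M (Ginv x) (x ⊗ y) m)
  >> ev_Ginv M x ((x ⊗ y) ▶ m).

Arguments delta_r {_} _ _ _ _.
Arguments delta_l {_} _ _ _ _.

Definition gv_delta_r (C : GVCategory) (x y z : C) :
  Hom ((x ⊙ y) ⊗ z) (x ⊙ (y ⊗ z)) := delta_r (regular C) x y z.

Definition gv_delta_l (C : GVCategory) (x y z : C) :
  Hom (x ⊗ (y ⊙ z)) ((x ⊗ y) ⊙ z) := delta_l (regular C) x y z.

(* Main.v *)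
Require Import Defs.

Set Implicit Arguments.
Unset Strict Implicit.
Unset Printing Implicit Defensive.

(** Every arrow [h] into [c ▶ m] is determined by its transpose
    [(G c ▷ h) >> ev c m] under the adjunction [G c ▷ - ⊣ c ▶ -], so each
    pentagon may be checked after transposing once for every black triangle in
    its target. What makes this effective is that the transposes of all the
    arrows involved are short, and contain no unit and no module constraint
    of [▶]:

    - the transpose of [delta_r M x y m] is an inverse associator followed by
      [odot_ev x y ▷ m], where [odot_ev x y : G x ⊗ (x ⊙ y) -> y] is the
      evaluation of the regular module ([delta_r_ev]);
    - the transpose of [delta_l M x y m] is an inverse associator followed by
      [contract x y ▷ (y ▶ m)] and the evaluation at [y], where
      [contract x y : G (x ⊗ y) ⊗ x -> G y] is the currying of the pairing of
      [G (x ⊗ y)] with [x ⊗ y] ([delta_l_ev]);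
    - the double transpose of the constraint of [▶] is an inverse associator
      followed by the isomorphism [G (x ⊙ y) = G y ⊗ G x] and an evaluation
      ([bact_assoc_ev]).

    After transposition the associators of [▷] can be collected at the left by
    naturality; they match by the pentagon axiom of the action. What is left
    is the image, under the action on an object of the module, of an identity in
    the GV-category alone. When the target has one black triangle and a distributor of the
    regular module occurs, this identity is the description of that distributor
    ([gv_delta_r_ev], [gv_delta_l_ev]); when the associator of [⊙] occurs, it
    is the description of that associator ([odot_assoc_ev]). In the other three
    cases it says how [contract] behaves on a triple tensor product, on
    [y ⊙ z] in the second argument, and on [x ⊙ y] in the first
    ([contract_assoc], [contract_odot], [contract_odot_ev]). These compare
    arrows into some [G w], and hold because they hold after pairing with [w]:
    both sides then reduce to the same arrow by the pentagon axiom of the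
    tensor product. *)

(** * Composition in categories and bifunctors *)

(** Composites are kept associated to the right; this turns an equation
    between composites into one that can be rewritten in front of any tail. *)
Lemma comp_eq_tail (C : Category) (w x y z : C) (f : Hom w x) (g : Hom x y)
  (h : Hom w y) (k : Hom y z) : f >> g = h -> f >> (g >> k) = h >> k.
Proof. intros e. rewrite <- comp_assoc, e. reflexivity. Qed.

Lemma bmap_compl (C D E : Category) (B : Bifunctor C D E)
  (c c' c'' : C) (d : D) (f : Hom c c') (f' : Hom c' c'') :
  bmap B (f >> f') (idm d) = bmap B f (idm d) >> bmap B f' (idm d).
Proof. rewrite <- bmap_comp, comp_idl. reflexivity. Qed.

Lemma bmap_compr (C D E : Category) (B : Bifunctor C D E)
  (c : C) (d d' d'' : D) (g : Hom d d') (g' : Hom d' d'') :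
  bmap B (idm c) (g >> g') = bmap B (idm c) g >> bmap B (idm c) g'.
Proof. rewrite <- bmap_comp, comp_idl. reflexivity. Qed.

(** * Associators and pentagons *)

Lemma mon_assoc_nat_l (C : MonoidalCategory) (x x' y z : C) (f : Hom x x') :
  ((f ⊗₁ idm y) ⊗₁ idm z) >> mon_assoc x' y z
  = mon_assoc x y z >> (f ⊗₁ idm (y ⊗ z)).
Proof. rewrite mon_assoc_nat, bmap_id. reflexivity. Qed.

Lemma mon_assoc_nat_r (C : MonoidalCategory) (x y z z' : C) (h : Hom z z') :
  (idm (x ⊗ y) ⊗₁ h) >> mon_assoc x y z'
  = mon_assoc x y z >> (idm x ⊗₁ (idm y ⊗₁ h)).
Proof. rewrite <- bmap_id, mon_assoc_nat. reflexivity. Qed.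

Lemma mon_pentagon_assocV (C : MonoidalCategory) (x y z w v : C)
  (k : Hom (x ⊗ ((y ⊗ z) ⊗ w)) v) :
  mon_assoc (x ⊗ y) z w
    >> (mon_assoc x y (z ⊗ w)
        >> ((idm x ⊗₁ iso_bwd (mon_assoc y z w)) >> k))
  = (mon_assoc x y z ⊗₁ idm w) >> (mon_assoc x (y ⊗ z) w >> k).
Proof.
  rewrite (comp_eq_tail _ (mon_pentagon _ _ _ _)), !comp_assoc.
  rewrite <- (comp_assoc (idm x ⊗₁ _)), <- bmap_compr, iso_fwdK, bmap_id.
  rewrite comp_idl. reflexivity.
Qed.

Lemma act_assocV_nat_l (C : MonoidalCategory) (M : ModuleCategory C)
  (x x' y : C) (m : M) (f : Hom x x') :
  (f ▷₁ idm (y ▷ m)) >> iso_bwd (act_assoc M x' y m)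
  = iso_bwd (act_assoc M x y m) >> ((f ⊗₁ idm y) ▷₁ idm m).
Proof. rewrite <- act_assoc_natV, bmap_id. reflexivity. Qed.

Lemma act_assocV_nat_r (C : MonoidalCategory) (M : ModuleCategory C)
  (x y : C) (m m' : M) (h : Hom m m') :
  (idm x ▷₁ (idm y ▷₁ h)) >> iso_bwd (act_assoc M x y m')
  = iso_bwd (act_assoc M x y m) >> (idm (x ⊗ y) ▷₁ h).
Proof. rewrite act_assoc_natV, bmap_id. reflexivity. Qed.

(** The pentagon axiom in the form that transposition produces: the constraints
    occur inverted, because evaluations are applied after regrouping the duals
    to the left. The variants that follow solve it for other sides and allow a
    tail. *)
Lemma act_pentagonV (C : MonoidalCategory) (M : ModuleCategory C)
  (x y z : C) (m : M) :
  (idm x ▷₁ iso_bwd (act_assoc M y z m)) >> iso_bwd (act_assoc M x (y ⊗ z) m)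
  = iso_bwd (act_assoc M x y (z ▷ m))
    >> (iso_bwd (act_assoc M (x ⊗ y) z m) >> (mon_assoc x y z ▷₁ idm m)).
Proof.
  apply (iso_cancel_l
    (i := iso_comp (act_assoc M (x ⊗ y) z m) (act_assoc M x y (z ▷ m)))).
  apply (iso_cancel_r (i := act_assoc M x (y ⊗ z) m)).
  apply (iso_cancel_r (i := bmap_iso (act M) (iso_id x) (act_assoc M y z m))).
  cbn. rewrite !comp_assoc.
  do 2 rewrite (comp_eq_tail _ (iso_fwdK _)), comp_idl.
  rewrite (comp_eq_tail _ (iso_bwdK _)), comp_idl, <- bmap_compr, iso_bwdK, bmap_id.
  rewrite comp_idr, act_pentagon, comp_assoc. reflexivity.
Qed.

Lemma act_pentagonV_tail (C : MonoidalCategory) (M : ModuleCategory C)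
  (x y z : C) (m n : M) (k : Hom ((x ⊗ (y ⊗ z)) ▷ m) n) :
  iso_bwd (act_assoc M x y (z ▷ m))
    >> (iso_bwd (act_assoc M (x ⊗ y) z m) >> ((mon_assoc x y z ▷₁ idm m) >> k))
  = (idm x ▷₁ iso_bwd (act_assoc M y z m))
    >> (iso_bwd (act_assoc M x (y ⊗ z) m) >> k).
Proof. rewrite (comp_eq_tail _ (act_pentagonV _ _ _ _)), !comp_assoc. reflexivity. Qed.

Lemma act_pentagonV_assocV (C : MonoidalCategory) (M : ModuleCategory C)
  (x y z : C) (m n : M) (k : Hom (((x ⊗ y) ⊗ z) ▷ m) n) :
  (idm x ▷₁ iso_bwd (act_assoc M y z m))
    >> (iso_bwd (act_assoc M x (y ⊗ z) m)
        >> ((iso_bwd (mon_assoc x y z) ▷₁ idm m) >> k))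
  = iso_bwd (act_assoc M x y (z ▷ m))
    >> (iso_bwd (act_assoc M (x ⊗ y) z m) >> k).
Proof.
  rewrite (comp_eq_tail _ (act_pentagonV _ _ _ _)), !comp_assoc.
  rewrite <- (comp_assoc (_ ▷₁ _)), <- bmap_compl, iso_fwdK, bmap_id, comp_idl.
  reflexivity.
Qed.

Lemma act_pentagonV_assoc (C : MonoidalCategory) (M : ModuleCategory C)
  (x y z : C) (m n : M) (k : Hom (((x ⊗ y) ⊗ z) ▷ m) n) :
  (idm x ▷₁ act_assoc M y z m)
    >> (iso_bwd (act_assoc M x y (z ▷ m))
        >> (iso_bwd (act_assoc M (x ⊗ y) z m) >> k))
  = iso_bwd (act_assoc M x (y ⊗ z) m)
    >> ((iso_bwd (mon_assoc x y z) ▷₁ idm m) >> k).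
Proof.
  rewrite <- act_pentagonV_assocV, <- (comp_assoc (_ ▷₁ _)), <- bmap_compr.
  rewrite iso_fwdK, bmap_id. apply comp_idl.
Qed.

(** * Transposition along the adjunctions defining the second action *)

Lemma ev_inj (C : GVCategory) (M : GVModule C) (c : C) (m n : M)
  (h k : Hom n (c ▶ m)) :
  (idm (G c) ▷₁ h) >> ev M c m = (idm (G c) ▷₁ k) >> ev M c m -> h = k.
Proof. exact (@untranspose_inj _ _ _ (gvm_adj M c) n m h k). Qed.

(** Since [▶] is defined on arrows by transposition, the evaluation is natural in
    the module argument and dinatural in the argument of the category. *)
Lemma bact_ev (C : GVCategory) (M : GVModule C) (c c' : C) (m m' : M)
  (f : Hom c c') (g : Hom m m') :
  (idm (G c') ▷₁ (f ▶₁ g)) >> ev M c' m'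
  = (G_map f ▷₁ idm (c ▶ m)) >> (ev M c m >> g).
Proof.
  rewrite <- comp_assoc. exact (transposeK (gvm_adj M c') _).
Qed.

(** Since [x ⊙ y] unfolds to [Ginv (G y ⊗ G x)], this is a counit of the
    equivalence; typing it with [x ⊙ y] lets it compose with the arrows below
    without unfolding. *)
Definition G_odot (C : GVCategory) (x y : C) : Iso (G (x ⊙ y)) (G y ⊗ G x) :=
  GGinv (G y ⊗ G x).

(** The constraint of [▶] is a double transpose by construction; transposing it
    back twice exposes what it was built from. *)
Lemma bact_assoc_ev (C : GVCategory) (M : GVModule C) (x y : C) (m : M) :
  (idm (G y) ▷₁ (idm (G x) ▷₁ bact_assoc M x y m))
    >> ((idm (G y) ▷₁ ev M x (y ▶ m)) >> ev M y m)
  = iso_bwd (act_assoc M (G y) (G x) ((x ⊙ y) ▶ m))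
    >> ((iso_bwd (G_odot x y) ▷₁ idm ((x ⊙ y) ▶ m)) >> ev M (x ⊙ y) m).
Proof.
  rewrite <- comp_assoc, <- bmap_compr, <- comp_assoc.
  etransitivity;
    [apply (f_equal (fun t => bmap (act M) (idm (G y)) t >> ev M y m)),
       (transposeK (gvm_adj M x))|].
  exact (transposeK (gvm_adj M y) _).
Qed.

(** The evaluation of the regular module, with its type written in terms of [⊗]
    and [⊙]. *)
Definition odot_ev (C : GVCategory) (x y : C) : Hom (G x ⊗ (x ⊙ y)) y :=
  ev (regular C) x y.

(** The associator of [⊙] is the constraint of the regular module, so its double
    transpose is a case of [bact_assoc_ev]. *)
Lemma odot_assoc_ev (C : GVCategory) (x y z : C) :
  (idm (G y) ⊗₁ (idm (G x) ⊗₁ odot_assoc x y z))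
    >> ((idm (G y) ⊗₁ odot_ev x (y ⊙ z)) >> odot_ev y z)
  = iso_bwd (mon_assoc (G y) (G x) ((x ⊙ y) ⊙ z))
    >> ((iso_bwd (G_odot x y) ⊗₁ idm ((x ⊙ y) ⊙ z)) >> odot_ev (x ⊙ y) z).
Proof.
  rewrite <- (regular_bact_assoc x y z). exact (bact_assoc_ev (M := regular C) x y z).
Qed.

(** * The pairing of an object with its dual *)

(** The universal arrow exhibiting [G y] as representing [Hom (- ⊗ y) K]. *)
Definition pairing (C : GVCategory) (y : C) : Hom (G y ⊗ y) (gv_K C) :=
  guncurry (idm (G y)).
Arguments pairing {_} _.

Lemma guncurry_pairing (C : GVCategory) (x y : C) (h : Hom x (G y)) :
  guncurry h = (h ⊗₁ idm y) >> pairing y.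
Proof. unfold pairing. rewrite <- guncurry_nat, comp_idr. reflexivity. Qed.

(** The uniqueness half of representability: identities between arrows into a
    dual are proved by pairing. *)
Lemma pairing_inj (C : GVCategory) (x y : C) (h k : Hom x (G y)) :
  (h ⊗₁ idm y) >> pairing y = (k ⊗₁ idm y) >> pairing y -> h = k.
Proof. rewrite <- !guncurry_pairing. apply guncurry_inj. Qed.

Lemma pairing_dinat (C : GVCategory) (y y' : C) (f : Hom y y') :
  (G_map f ⊗₁ idm y) >> pairing y = (idm (G y') ⊗₁ f) >> pairing y'.
Proof.
  rewrite <- guncurry_pairing, <- (comp_idl (G_map f)), guncurry_G_map.
  reflexivity.
Qed.

(** The bijection defining the evaluation of the regular module passes through
    [G], so that [G_map (odot_ev x y)] is a currying of the pairing of
    [G (x ⊙ y)] with [x ⊙ y]. Dinaturality of the pairing moves [odot_ev] out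
    of [G_map]. *)
Lemma odot_ev_pairing (C : GVCategory) (x y : C) :
  (iso_bwd (G_odot x y) ⊗₁ idm (x ⊙ y)) >> pairing (x ⊙ y)
  = mon_assoc (G y) (G x) (x ⊙ y)
    >> ((idm (G y) ⊗₁ odot_ev x y) >> pairing y).
Proof.
  rewrite <- pairing_dinat, <- !guncurry_pairing.
  change (odot_ev x y) with (hom_l_inv (a := G x) (z := y) (idm (x ⊙ y))).
  unfold hom_l_inv. rewrite G_mapK, gcurryK, (comp_eq_tail _ (iso_fwdK _)), comp_idl.
  etransitivity; [|apply f_equal, f_equal, eq_sym, G_map_id].
  rewrite comp_idr. reflexivity.
Qed.

(** What the left distributor amounts to on the side of duals: [x] cancels
    against the first factor of [x ⊗ y] dualized. *)
Definition contract (C : GVCategory) (x y : C) : Hom (G (x ⊗ y) ⊗ x) (G y) :=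
  gcurry (mon_assoc (G (x ⊗ y)) x y >> pairing (x ⊗ y)).

Lemma contract_pairing (C : GVCategory) (x y : C) :
  (contract x y ⊗₁ idm y) >> pairing y
  = mon_assoc (G (x ⊗ y)) x y >> pairing (x ⊗ y).
Proof. rewrite <- guncurry_pairing. apply gcurryK. Qed.

Lemma contract_dinat (C : GVCategory) (x x' y : C) (f : Hom x x') :
  (G_map (f ⊗₁ idm y) ⊗₁ idm x) >> contract x y
  = (idm (G (x' ⊗ y)) ⊗₁ f) >> contract x' y.
Proof.
  apply pairing_inj. rewrite !bmap_compl, !comp_assoc, !contract_pairing.
  rewrite !(comp_eq_tail _ (mon_assoc_nat _ _ _)), !comp_assoc, bmap_id.
  rewrite pairing_dinat. reflexivity.
Qed.

(** * The distributors after transposition *)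

(** The unit in the definition of [delta_r] cancels against the evaluation by a
    triangle identity. *)
Lemma delta_r_ev (C : GVCategory) (M : GVModule C) (x y : C) (m : M) :
  (idm (G x) ▷₁ delta_r M x y m) >> ev M x (y ▷ m)
  = iso_bwd (act_assoc M (G x) (x ⊙ y) m) >> (odot_ev x y ▷₁ idm m).
Proof.
  unfold delta_r. rewrite !bmap_compr, !comp_assoc, bact_ev.
  rewrite G_map_id, bmap_id, comp_idl, (comp_eq_tail _ (bact_ev _ _)).
  rewrite G_map_id, bmap_id, comp_idl, !comp_assoc.
  rewrite (comp_eq_tail (h := idm _)); [apply comp_idl|].
  exact (adj_triangle_l (gvm_adj M x) ((x ⊙ y) ▷ m)).
Qed.

Lemma gv_delta_r_ev (C : GVCategory) (x y z : C) :
  (idm (G x) ⊗₁ gv_delta_r x y z) >> odot_ev x (y ⊗ z)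
  = iso_bwd (mon_assoc (G x) (x ⊙ y) z) >> (odot_ev x y ⊗₁ idm z).
Proof. exact (delta_r_ev (M := regular C) x y z). Qed.

(** The unit of the regular module is [hom_l] of an identity, and [G_map] of that
    is a currying of the pairing, that is, [contract (G (Ginv x)) y] up to
    [G_odot]. Dinaturality of [contract] absorbs the replacement of
    [G (Ginv x)] by [x]. *)
Lemma coev_Ginv_contract (C : GVCategory) (x y : C) :
  (idm (G (x ⊗ y)) ⊗₁ iso_bwd (GGinv x))
    >> (iso_bwd (G_odot (Ginv x) (x ⊗ y)) >> G_map (coev_Ginv x y))
  = contract x y.
Proof.
  assert (e : G_map (coev (regular C) (Ginv x) y
                       : Hom y (Ginv x ⊙ (G (Ginv x) ⊗ y)))
              = GGinv _ >> contract (G (Ginv x)) y).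
  { change (coev (regular C) (Ginv x) y)
      with (hom_l (a := G (Ginv x)) (y := y) (idm (G (Ginv x) ⊗ y))).
    unfold hom_l. rewrite G_mapK, G_map_id. reflexivity. }
  unfold coev_Ginv, G_odot.
  etransitivity; [apply f_equal, f_equal, G_map_comp|].
  etransitivity; [apply f_equal, f_equal, f_equal, e|].
  cbn. rewrite (comp_eq_tail _ (GGinv_natV _)), !comp_assoc.
  rewrite (comp_eq_tail _ (iso_bwdK _)), comp_idl, G_map_id, contract_dinat.
  rewrite <- comp_assoc, <- bmap_compr, iso_bwdK, bmap_id, comp_idl.
  reflexivity.
Qed.

(** With [c = Ginv x], transposing along [x ⊗ y] meets the constraint of [▶] at
    [c] and [x ⊗ y], whose double transpose removes the evaluation at [c]. The
    remaining unit acts through [G_map] by dinaturality of the evaluation, and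
    [coev_Ginv_contract] recognizes the result. *)
Lemma delta_l_ev (C : GVCategory) (M : GVModule C) (x y : C) (m : M) :
  (idm (G (x ⊗ y)) ▷₁ delta_l M x y m) >> ev M (x ⊗ y) m
  = iso_bwd (act_assoc M (G (x ⊗ y)) x (y ▶ m))
    >> ((contract x y ▷₁ idm (y ▶ m)) >> ev M y m).
Proof.
  rewrite <- coev_Ginv_contract. unfold delta_l, ev_Ginv.
  rewrite !bmap_compr, !comp_assoc.
  (* The evaluation at [Ginv x] consumes [G (Ginv x)], so the isomorphism with
     [x] has to be moved before the two arrows under [x ▷ -]. *)
  assert (swap : forall (n n' : M) (h : Hom n n'),
    (idm (G (x ⊗ y)) ▷₁ (idm x ▷₁ h))
      >> (idm (G (x ⊗ y)) ▷₁ (iso_bwd (GGinv x) ▷₁ idm n'))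
    = (idm (G (x ⊗ y)) ▷₁ (iso_bwd (GGinv x) ▷₁ idm n))
      >> (idm (G (x ⊗ y)) ▷₁ (idm (G (Ginv x)) ▷₁ h))).
  { intros n n' h. rewrite <- !bmap_compr, bmap_swap. reflexivity. }
  rewrite (comp_eq_tail _ (swap _ _ _)), !comp_assoc, (comp_eq_tail _ (swap _ _ _)).
  rewrite comp_assoc, bact_assoc_ev, (comp_eq_tail _ (act_assoc_natV _ _ _)).
  rewrite !comp_assoc, !bmap_id.
  rewrite (comp_eq_tail _ (bmap_swap _ _ _)), comp_assoc, bact_ev, comp_idr.
  rewrite (comp_eq_tail _ (act_assoc_natV _ _ _)), !bmap_compl, !comp_assoc.
  reflexivity.
Qed.

Lemma gv_delta_l_ev (C : GVCategory) (x y z : C) :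
  (idm (G (x ⊗ y)) ⊗₁ gv_delta_l x y z) >> odot_ev (x ⊗ y) z
  = iso_bwd (mon_assoc (G (x ⊗ y)) x (y ⊙ z))
    >> ((contract x y ⊗₁ idm (y ⊙ z)) >> odot_ev y z).
Proof. exact (delta_l_ev (M := regular C) x y z). Qed.

(** * Contraction and the two tensor products *)

(** Contracting [x ⊗ y] at once is contracting [x] and then [y]: paired with [z],
    both give the pairing of [G (x ⊗ (y ⊗ z))] with [x ⊗ (y ⊗ z)]. *)
Lemma contract_assoc (C : GVCategory) (x y z : C) :
  (G_map (mon_assoc x y z) ⊗₁ idm (x ⊗ y)) >> contract (x ⊗ y) z
  = iso_bwd (mon_assoc (G (x ⊗ (y ⊗ z))) x y)
    >> ((contract x (y ⊗ z) ⊗₁ idm y) >> contract y z).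
Proof.
  apply pairing_inj. rewrite !bmap_compl, !comp_assoc, !contract_pairing.
  rewrite (comp_eq_tail _ (mon_assoc_nat _ _ _)), bmap_id, comp_assoc.
  rewrite pairing_dinat, (comp_eq_tail _ (mon_assoc_nat _ _ _)), bmap_id, comp_assoc.
  rewrite contract_pairing.
  apply (iso_cancel_l (i := bmap_iso (tensor C)
    (mon_assoc (G (x ⊗ (y ⊗ z))) x y) (iso_id z))).
  cbn. rewrite <- (comp_assoc _ (_ ⊗₁ _) (mon_assoc _ _ _ >> _)).
  rewrite <- bmap_compl, iso_fwdK, bmap_id, comp_idl.
  rewrite <- !(comp_assoc (mon_assoc _ _ _)), mon_pentagon, !comp_assoc.
  reflexivity.
Qed.

(** Contracting [x] inside the dual of [x ⊗ (y ⊙ z)] is contracting it inside the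
    factor [G (x ⊗ y)] of the dual of [(x ⊗ y) ⊙ z], once the two duals are
    compared by the left distributor. Paired with [y ⊙ z], [odot_ev_pairing]
    turns both sides into evaluations, and the claim becomes the transposed
    description of that distributor. *)
Lemma contract_odot (C : GVCategory) (x y z : C) :
  ((iso_bwd (G_odot (x ⊗ y) z) >> G_map (gv_delta_l x y z)) ⊗₁ idm x)
    >> contract x (y ⊙ z)
  = mon_assoc (G z) (G (x ⊗ y)) x
    >> ((idm (G z) ⊗₁ contract x y) >> iso_bwd (G_odot y z)).
Proof.
  apply pairing_inj. rewrite !bmap_compl, !comp_assoc, !contract_pairing.
  rewrite (comp_eq_tail _ (mon_assoc_nat_l _ _ _)), comp_assoc, pairing_dinat.
  rewrite (comp_eq_tail _ (mon_assoc_nat_l _ _ _)), comp_assoc, odot_ev_pairing.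
  rewrite (comp_eq_tail _ (mon_assoc_nat _ _ _)), comp_assoc.
  rewrite (comp_eq_tail _ (eq_sym (bmap_swap _ _ _))), comp_assoc, odot_ev_pairing.
  rewrite (comp_eq_tail _ (mon_assoc_nat_r _ _ _)), comp_assoc.
  rewrite (comp_eq_tail _ (eq_sym (bmap_compr _ _ _ _))), gv_delta_l_ev.
  rewrite !bmap_compr, !comp_assoc.
  apply mon_pentagon_assocV.
Qed.

(** The counterpart of [contract_odot] for the right distributor: contracting
    [x ⊙ y] amounts to evaluating it at [G x] and contracting the resulting
    [y]. *)
Lemma contract_odot_ev (C : GVCategory) (x y z : C) :
  ((iso_bwd (G_odot x (y ⊗ z)) >> G_map (gv_delta_r x y z))
     ⊗₁ idm (x ⊙ y)) >> contract (x ⊙ y) z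
  = mon_assoc (G (y ⊗ z)) (G x) (x ⊙ y)
    >> ((idm (G (y ⊗ z)) ⊗₁ odot_ev x y) >> contract y z).
Proof.
  apply pairing_inj. rewrite !bmap_compl, !comp_assoc, !contract_pairing.
  rewrite (comp_eq_tail _ (mon_assoc_nat_l _ _ _)), comp_assoc, pairing_dinat.
  rewrite (comp_eq_tail _ (mon_assoc_nat_l _ _ _)), comp_assoc.
  rewrite (comp_eq_tail _ (mon_assoc_nat _ _ _)), comp_assoc.
  rewrite (comp_eq_tail _ (eq_sym (bmap_swap _ _ _))), comp_assoc, odot_ev_pairing.
  rewrite (comp_eq_tail _ (mon_assoc_nat_r _ _ _)), comp_assoc.
  rewrite (comp_eq_tail _ (eq_sym (bmap_compr _ _ _ _))), gv_delta_r_ev.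
  rewrite bmap_compr, comp_assoc.
  apply mon_pentagon_assocV.
Qed.

(** * The six pentagons *)

Lemma delta_r_odot_pentagon (C : GVCategory) (M : GVModule C) (x y z : C)
  (m : M) :
  (odot_assoc x y z ▷₁ idm m)
      >> delta_r M x (y ⊙ z) m
      >> (idm x ▶₁ delta_r M y z m)
    = delta_r M (x ⊙ y) z m
      >> bact_assoc M x y (z ▷ m).
Proof.
  apply ev_inj. rewrite !comp_assoc, !bmap_compr, !comp_assoc.
  rewrite bact_ev, G_map_id, bmap_id, comp_idl.
  rewrite (comp_eq_tail _ (delta_r_ev _ _ _)).
  apply ev_inj. rewrite !bmap_compr, !comp_assoc.
  rewrite delta_r_ev.
  rewrite bact_assoc_ev.
  rewrite <- (comp_assoc (_ ▷₁ (_ ▷₁ (_ ▷₁ _)))), <- bmap_compr, act_assoc_natV.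
  rewrite bmap_compr, !comp_assoc.
  rewrite (comp_eq_tail _ (act_assocV_nat_r _ _ _)), comp_assoc.
  rewrite (comp_eq_tail _ (act_assoc_natV _ _ _)), comp_assoc.
  rewrite (comp_eq_tail _ (act_assoc_natV _ _ _)), comp_assoc.
  (* The left side ends with the image under [- ▷ m] of the double transpose of
     the associator of [⊙]. *)
  rewrite <- !bmap_compl, odot_assoc_ev, !bmap_compl, act_pentagonV_assocV.
  rewrite (comp_eq_tail _ (bmap_swap _ _ _)), comp_assoc, delta_r_ev.
  rewrite (comp_eq_tail _ (act_assocV_nat_l _ _ _)), comp_assoc. reflexivity.
Qed.

Lemma delta_r_tensor_pentagon (C : GVCategory) (M : GVModule C) (x y z : C)
  (m : M) :
  delta_r M x y (z ▷ m)
    = iso_bwd (act_assoc M (x ⊙ y) z m)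
      >> (gv_delta_r x y z ▷₁ idm m)
      >> delta_r M x (y ⊗ z) m
      >> (idm x ▶₁ act_assoc M y z m).
Proof.
  apply ev_inj. rewrite !comp_assoc, !bmap_compr, !comp_assoc.
  rewrite bact_ev, G_map_id, bmap_id, comp_idl, delta_r_ev.
  rewrite (comp_eq_tail _ (delta_r_ev _ _ _)).
  rewrite !comp_assoc, (comp_eq_tail _ (act_assoc_natV _ _ _)), !comp_assoc.
  rewrite <- (comp_assoc (_ ▷₁ idm m)), <- bmap_compl, gv_delta_r_ev, bmap_compl.
  rewrite comp_assoc, act_pentagonV_assocV, act_assoc_nat, bmap_id.
  rewrite (comp_eq_tail _ (iso_bwdK _)), comp_idl. reflexivity.
Qed.

Lemma delta_l_tensor_pentagon (C : GVCategory) (M : GVModule C) (x y z : C)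
  (m : M) :
  delta_l M (x ⊗ y) z m
      >> (mon_assoc x y z ▶₁ idm m)
    = act_assoc M x y (z ▶ m)
      >> (idm x ▷₁ delta_l M y z m)
      >> delta_l M x (y ⊗ z) m.
Proof.
  apply ev_inj. rewrite !comp_assoc, !bmap_compr, !comp_assoc.
  rewrite bact_ev, comp_idr.
  rewrite delta_l_ev.
  rewrite (comp_eq_tail _ (bmap_swap _ _ _)), comp_assoc, delta_l_ev.
  rewrite (comp_eq_tail _ (act_assocV_nat_l _ _ _)), comp_assoc.
  rewrite <- (comp_assoc (_ ▷₁ idm _)), <- bmap_compl, contract_assoc.
  rewrite !bmap_compl, !comp_assoc.
  rewrite (comp_eq_tail _ (act_assocV_nat_r _ _ _)), comp_assoc.
  rewrite (comp_eq_tail _ (bmap_swap _ _ _)), comp_assoc, delta_l_ev.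
  rewrite (comp_eq_tail _ (act_assocV_nat_l _ _ _)), comp_assoc.
  rewrite act_pentagonV_assoc. reflexivity.
Qed.

Lemma delta_l_odot_pentagon (C : GVCategory) (M : GVModule C) (x y z : C)
  (m : M) :
  delta_l M x (y ⊙ z) m
      >> (gv_delta_l x y z ▶₁ idm m)
      >> bact_assoc M (x ⊗ y) z m
    = (idm x ▷₁ bact_assoc M y z m)
      >> delta_l M x y (z ▶ m).
Proof.
  apply ev_inj. rewrite !comp_assoc, !bmap_compr, !comp_assoc.
  rewrite (delta_l_ev x y).
  apply ev_inj. rewrite !bmap_compr, !comp_assoc.
  rewrite bact_assoc_ev.
  rewrite (comp_eq_tail _ (act_assocV_nat_r _ _ _)), comp_assoc.
  rewrite (comp_eq_tail _ (bmap_swap _ _ _)), comp_assoc, bact_ev, comp_idr.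
  rewrite (comp_eq_tail _ (act_assocV_nat_r _ _ _)), comp_assoc.
  rewrite (comp_eq_tail _ (bmap_swap _ _ _)), comp_assoc.
  rewrite (comp_eq_tail _ (bmap_swap _ _ _)), comp_assoc, delta_l_ev.
  (* The distributor of the regular module acts inside [▶], so transposition
     has turned it into its image under [G_map]. *)
  rewrite <- (comp_assoc (_ ▷₁ _) (G_map _ ▷₁ _)), <- bmap_compl.
  rewrite (comp_eq_tail _ (act_assocV_nat_l _ _ _)), comp_assoc.
  rewrite <- (comp_assoc (_ ▷₁ _) (contract _ _ ▷₁ _)), <- bmap_compl.
  rewrite contract_odot.
  rewrite !bmap_compl, !comp_assoc, act_pentagonV_tail.
  (* On the right side the constraint of [▶] commutes with the contraction, so
     that it reaches the two evaluations that transpose it. *)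
  rewrite <- !(comp_assoc (idm (G z) ▷₁ (idm _ ▷₁ (idm x ▷₁ _)))), <- bmap_compr.
  rewrite act_assocV_nat_r, bmap_compr, !comp_assoc.
  rewrite <- (comp_assoc _ (_ ▷₁ (contract _ _ ▷₁ _))), <- bmap_compr, bmap_swap.
  rewrite bmap_compr, !comp_assoc, bact_assoc_ev.
  rewrite (comp_eq_tail _ (act_assoc_natV _ _ _)), comp_assoc. reflexivity.
Qed.

Lemma delta_l_delta_r_tensor_pentagon (C : GVCategory) (M : GVModule C) (x y z : C)
  (m : M) :
  (gv_delta_l x y z ▷₁ idm m)
      >> delta_r M (x ⊗ y) z m
    = act_assoc M x (y ⊙ z) m
      >> (idm x ▷₁ delta_r M y z m)
      >> delta_l M x y (z ▷ m).
Proof.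
  apply ev_inj. rewrite !comp_assoc, !bmap_compr, !comp_assoc.
  rewrite delta_r_ev, delta_l_ev.
  rewrite (comp_eq_tail _ (act_assoc_natV _ _ _)), comp_assoc, <- bmap_compl.
  rewrite gv_delta_l_ev, !bmap_compl.
  rewrite (comp_eq_tail _ (act_assocV_nat_r _ _ _)), comp_assoc.
  rewrite (comp_eq_tail _ (bmap_swap _ _ _)), comp_assoc, delta_r_ev.
  rewrite (comp_eq_tail _ (act_assocV_nat_l _ _ _)), comp_assoc.
  rewrite act_pentagonV_assoc. reflexivity.
Qed.

Lemma delta_r_delta_l_odot_pentagon (C : GVCategory) (M : GVModule C) (x y z : C)
  (m : M) :
  delta_r M x y (z ▶ m)
      >> (idm x ▶₁ delta_l M y z m)
    = delta_l M (x ⊙ y) z m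
      >> (gv_delta_r x y z ▶₁ idm m)
      >> bact_assoc M x (y ⊗ z) m.
Proof.
  apply ev_inj. rewrite !comp_assoc, !bmap_compr, !comp_assoc.
  rewrite bact_ev, G_map_id, bmap_id, comp_idl.
  rewrite (comp_eq_tail _ (delta_r_ev _ _ _)).
  apply ev_inj. rewrite !bmap_compr, !comp_assoc.
  rewrite bact_assoc_ev, delta_l_ev.
  rewrite (comp_eq_tail _ (act_assocV_nat_r _ _ _)), comp_assoc.
  rewrite (comp_eq_tail _ (bmap_swap _ _ _)), comp_assoc, bact_ev, comp_idr.
  rewrite (comp_eq_tail _ (act_assocV_nat_r _ _ _)), comp_assoc.
  rewrite (comp_eq_tail _ (bmap_swap _ _ _)), comp_assoc.
  rewrite (comp_eq_tail _ (bmap_swap _ _ _)), comp_assoc, delta_l_ev.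
  (* The distributor of the regular module acts inside [▶], so transposition
     has turned it into its image under [G_map]. *)
  rewrite <- (comp_assoc (_ ▷₁ _) (G_map _ ▷₁ _)), <- bmap_compl.
  rewrite (comp_eq_tail _ (act_assocV_nat_l _ _ _)), comp_assoc.
  rewrite <- (comp_assoc (_ ▷₁ _) (contract _ _ ▷₁ _)), <- bmap_compl.
  rewrite contract_odot_ev.
  rewrite !bmap_compl, !comp_assoc, act_pentagonV_tail.
  rewrite (comp_eq_tail _ (act_assoc_natV _ _ _)), comp_assoc. reflexivity.
Qed.

Theorem proposition3p28 (C : GVCategory) (M : GVModule C) (x y z : C) (m : M) :
  (* 1(a) *)
  ((odot_assoc x y z ▷₁ idm m)
     >> delta_r M x (y ⊙ z) m
     >> (idm x ▶₁ delta_r M y z m)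
   = delta_r M (x ⊙ y) z m
     >> bact_assoc M x y (z ▷ m)) /\
  (* 1(b) *)
  (delta_r M x y (z ▷ m)
   = iso_bwd (act_assoc M (x ⊙ y) z m)
     >> (gv_delta_r x y z ▷₁ idm m)
     >> delta_r M x (y ⊗ z) m
     >> (idm x ▶₁ act_assoc M y z m)) /\
  (* 2(a) *)
  (delta_l M (x ⊗ y) z m
     >> (mon_assoc x y z ▶₁ idm m)
   = act_assoc M x y (z ▶ m)
     >> (idm x ▷₁ delta_l M y z m)
     >> delta_l M x (y ⊗ z) m) /\
  (* 2(b) *)
  (delta_l M x (y ⊙ z) m
     >> (gv_delta_l x y z ▶₁ idm m)
     >> bact_assoc M (x ⊗ y) z m
   = (idm x ▷₁ bact_assoc M y z m)
     >> delta_l M x y (z ▶ m)) /\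
  (* 3(a) *)
  ((gv_delta_l x y z ▷₁ idm m)
     >> delta_r M (x ⊗ y) z m
   = act_assoc M x (y ⊙ z) m
     >> (idm x ▷₁ delta_r M y z m)
     >> delta_l M x y (z ▷ m)) /\
  (* 3(b) *)
  (delta_r M x y (z ▶ m)
     >> (idm x ▶₁ delta_l M y z m)
   = delta_l M (x ⊙ y) z m
     >> (gv_delta_r x y z ▶₁ idm m)
     >> bact_assoc M x (y ⊗ z) m).
Proof.
  repeat split.
  - apply delta_r_odot_pentagon.
  - apply delta_r_tensor_pentagon.
  - apply delta_l_tensor_pentagon.
  - apply delta_l_odot_pentagon.
  - apply delta_l_delta_r_tensor_pentagon.
  - apply delta_r_delta_l_odot_pentagon.
Qed.
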